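(* For every MAV structure $P$: if $P \longrightarrow^* \mathbf{1}$ in (full) MAV, then there is a normal derivation $P \longrightarrow^* \mathbf{1}$.
   Context: Fix a set of atoms $a$. MAV structures are generated by $P,Q,R,S ::= a \mid a^\perp \mid \mathbf{1} \mid P;Q \mid P\otimes Q \mid P⅋Q \mid P\& Q \mid P\oplus Q$. Duality $(-)^\perp$ is defined by $(a)^\perp=a^\perp$, $(a^\perp)^\perp=a$, $\mathbf 1^\perp=\mathbf 1$, $(P\otimes Q)^\perp=P^\perp⅋Q^\perp$, $(P⅋Q)^\perp=P^\perp\otimes Q^\perp$, $(P;Q)^\perp=P^\perp;Q^\perp$, $(P\&Q)^\perp=P^\perp\oplus Q^\perp$, $(P\oplus Q)^\perp=P^\perp\&Q^\perp$. Structures are identified modulo the least congruence $\equiv$ making $(;,\mathbf 1)$ a monoid and $(\otimes,\mathbf 1)$, $(⅋,\mathbf 1)$ commutative monoids. A context $C[-]$ is a structure with one hole, and $C[P]$ fills the hole with $P$. The one-step inference relation $P\longrightarrow Q$ (read: ''$P$ can be inferred from $Q$'') is the least relation containing the following axioms and closed under contexts (if $P\longrightarrow Q$ then $C[P]\longrightarrow C[Q]$): Interact: $P⅋P^\perp\longrightarrow\mathbf 1$; Switch: $(P\otimes Q)⅋R\longrightarrow P\otimes(Q⅋R)$; Tidy: $\mathbf 1\&\mathbf 1\longrightarrow\mathbf 1$; Sequence: $(P;Q)⅋(R;S)\longrightarrow(P⅋R);(Q⅋S)$; Left: $P\oplus Q\longrightarrow P$; Right: $P\oplus Q\longrightarrow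 Q$; External: $(P\&Q)⅋R\longrightarrow(P⅋R)\&(Q⅋R)$; Medial: $(P;Q)\&(R;S)\longrightarrow(P\&R);(Q\&S)$; CoInteract: $\mathbf 1\longrightarrow P\otimes P^\perp$; CoTidy: $\mathbf 1\longrightarrow\mathbf 1\oplus\mathbf 1$; CoSequence: $(P\otimes R);(Q\otimes S)\longrightarrow(P;Q)\otimes(R;S)$; CoLeft: $P\longrightarrow P\&Q$; CoRight: $Q\longrightarrow P\&Q$; CoExternal: $(P\otimes R)\oplus(Q\otimes R)\longrightarrow(P\oplus Q)\otimes R$; CoMedial: $(P\oplus R);(Q\oplus S)\longrightarrow(P;Q)\oplus(R;S)$. $\longrightarrow^*$ is the reflexive–transitive closure (derivation); a proof of $P$ is a derivation $P\longrightarrow^*\mathbf 1$. A derivation is normal if it uses none of the Co- rules and uses Interact only in the atomic form AtomInteract: $a^\perp⅋a\longrightarrow\mathbf 1$ (i.e. its steps are context-closed instances of Switch, Tidy, Sequence, Left, Right, External, Medial, AtomInteract, modulo $\equiv$). *)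

(* Defs.v *)
From Stdlib Require Import Relations.

Set Implicit Arguments.

Declare Scope mav_scope.
Delimit Scope mav_scope with mav.

Reserved Notation "P ;; Q" (at level 40, left associativity).
Reserved Notation "P ⊗ Q" (at level 40, left associativity).
Reserved Notation "P ⅋ Q" (at level 40, left associativity).
Reserved Notation "P ⊕ Q" (at level 40, left associativity).
Reserved Notation "P ≡ Q" (at level 70, no associativity).

Inductive structure (A : Type) : Type :=
| Atom (a : A)
| CoAtom (a : A)
| One
| Seq (P Q : structure A)
| Tensor (P Q : structure A)
| Par (P Q : structure A)
| With (P Q : structure A)
| Plus (P Q : structure A).

Arguments One {A}.

Notation "P ;; Q" := (Seq P Q) : mav_scope.
Notation "P ⊗ Q" := (Tensor P Q) : mav_scope.
Notation "P ⅋ Q" := (Par P Q) : mav_scope.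
Notation "P && Q" := (With P Q) : mav_scope.
Notation "P ⊕ Q" := (Plus P Q) : mav_scope.

Local Open Scope mav_scope.

Fixpoint dual (A : Type) (P : structure A) : structure A :=
  match P with
  | Atom a => CoAtom a
  | CoAtom a => Atom a
  | One => One
  | P ;; Q => dual P ;; dual Q
  | P ⊗ Q => dual P ⅋ dual Q
  | P ⅋ Q => dual P ⊗ dual Q
  | P && Q => dual P ⊕ dual Q
  | P ⊕ Q => dual P && dual Q
  end.

Inductive equiv (A : Type) : relation (structure A) :=
| equiv_refl P : P ≡ P
| equiv_sym P Q : P ≡ Q -> Q ≡ P
| equiv_trans P Q R : P ≡ Q -> Q ≡ R -> P ≡ R
| equiv_Seq P P' Q Q' : P ≡ P' -> Q ≡ Q' -> P ;; Q ≡ P' ;; Q'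
| equiv_Tensor P P' Q Q' : P ≡ P' -> Q ≡ Q' -> P ⊗ Q ≡ P' ⊗ Q'
| equiv_Par P P' Q Q' : P ≡ P' -> Q ≡ Q' -> P ⅋ Q ≡ P' ⅋ Q'
| equiv_With P P' Q Q' : P ≡ P' -> Q ≡ Q' -> P && Q ≡ P' && Q'
| equiv_Plus P P' Q Q' : P ≡ P' -> Q ≡ Q' -> P ⊕ Q ≡ P' ⊕ Q'
| Seq_assoc P Q R : (P ;; Q) ;; R ≡ P ;; (Q ;; R)
| Seq_One_l P : One ;; P ≡ P
| Seq_One_r P : P ;; One ≡ P
| Tensor_assoc P Q R : (P ⊗ Q) ⊗ R ≡ P ⊗ (Q ⊗ R)
| Tensor_comm P Q : P ⊗ Q ≡ Q ⊗ P
| Tensor_One P : P ⊗ One ≡ P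
| Par_assoc P Q R : (P ⅋ Q) ⅋ R ≡ P ⅋ (Q ⅋ R)
| Par_comm P Q : P ⅋ Q ≡ Q ⅋ P
| Par_One P : P ⅋ One ≡ P
where "P ≡ Q" := (equiv P Q) : mav_scope.

Inductive context (A : Type) : Type :=
| Hole
| CSeqL (C : context A) (Q : structure A)
| CSeqR (P : structure A) (C : context A)
| CTensorL (C : context A) (Q : structure A)
| CTensorR (P : structure A) (C : context A)
| CParL (C : context A) (Q : structure A)
| CParR (P : structure A) (C : context A)
| CWithL (C : context A) (Q : structure A)
| CWithR (P : structure A) (C : context A)
| CPlusL (C : context A) (Q : structure A)
| CPlusR (P : structure A) (C : context A).

Arguments Hole {A}.

Fixpoint fill (A : Type) (C : context A) (R : structure A) : structure A :=
  match C with
  | Hole => R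
  | CSeqL C Q => fill C R ;; Q
  | CSeqR P C => P ;; fill C R
  | CTensorL C Q => fill C R ⊗ Q
  | CTensorR P C => P ⊗ fill C R
  | CParL C Q => fill C R ⅋ Q
  | CParR P C => P ⅋ fill C R
  | CWithL C Q => fill C R && Q
  | CWithR P C => P && fill C R
  | CPlusL C Q => fill C R ⊕ Q
  | CPlusR P C => P ⊕ fill C R
  end.

(* Rules are oriented from conclusion to premise: [rule P Q] means that [P] can
   be inferred from [Q]. *)

Inductive mav_rule (A : Type) : relation (structure A) :=
| Interact P : mav_rule (P ⅋ dual P) One
| Switch P Q R : mav_rule ((P ⊗ Q) ⅋ R) (P ⊗ (Q ⅋ R))
| Tidy : mav_rule (One && One) One
| Sequence P Q R S : mav_rule ((P ;; Q) ⅋ (R ;; S)) ((P ⅋ R) ;; (Q ⅋ S))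
| Left P Q : mav_rule (P ⊕ Q) P
| Right P Q : mav_rule (P ⊕ Q) Q
| External P Q R : mav_rule ((P && Q) ⅋ R) ((P ⅋ R) && (Q ⅋ R))
| Medial P Q R S : mav_rule ((P ;; Q) && (R ;; S)) ((P && R) ;; (Q && S))
| CoInteract P : mav_rule One (P ⊗ dual P)
| CoTidy : mav_rule One (One ⊕ One)
| CoSequence P Q R S : mav_rule ((P ⊗ R) ;; (Q ⊗ S)) ((P ;; Q) ⊗ (R ;; S))
| CoLeft P Q : mav_rule P (P && Q)
| CoRight P Q : mav_rule Q (P && Q)
| CoExternal P Q R : mav_rule ((P ⊗ R) ⊕ (Q ⊗ R)) ((P ⊕ Q) ⊗ R)
| CoMedial P Q R S : mav_rule ((P ⊕ R) ;; (Q ⊕ S)) ((P ;; Q) ⊕ (R ;; S)).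

Inductive normal_rule (A : Type) : relation (structure A) :=
| N_AtomInteract a : normal_rule (CoAtom a ⅋ Atom a) One
| N_Switch P Q R : normal_rule ((P ⊗ Q) ⅋ R) (P ⊗ (Q ⅋ R))
| N_Tidy : normal_rule (One && One) One
| N_Sequence P Q R S : normal_rule ((P ;; Q) ⅋ (R ;; S)) ((P ⅋ R) ;; (Q ⅋ S))
| N_Left P Q : normal_rule (P ⊕ Q) P
| N_Right P Q : normal_rule (P ⊕ Q) Q
| N_External P Q R : normal_rule ((P && Q) ⅋ R) ((P ⅋ R) && (Q ⅋ R))
| N_Medial P Q R S : normal_rule ((P ;; Q) && (R ;; S)) ((P && R) ;; (Q && S)).

(* One inference step on [≡]-classes: both sides may be replaced by equivalent
   representatives. *)
Definition step (A : Type) (rule : relation (structure A)) : relation (structure A) :=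
  fun P Q => exists (C : context A) (P0 Q0 : structure A),
    P ≡ fill C P0 /\ rule P0 Q0 /\ fill C Q0 ≡ Q.

(* Structures are not quotiented, so [≡] is added to the steps: this makes the
   closure reflexive on [≡]-classes. *)
Definition derives (A : Type) (rule : relation (structure A)) : relation (structure A) :=
  clos_refl_trans (structure A) (fun P Q => P ≡ Q \/ step rule P Q).

Definition mav_derives (A : Type) : relation (structure A) := derives (@mav_rule A).

Definition normal_derives (A : Type) : relation (structure A) := derives (@normal_rule A).

(* Main.v *)
From Stdlib Require Import Relations Morphisms.
Require Import Defs.

(** Atkey and Kokke's semantic cut elimination.  Order structures by normal
    derivability.  The down-closed sets closed under [&&] ("ideals") carry a
    commutative product generated by [⅋], its residual, a product generated by
    [;], and a lattice structure.  A structure is interpreted, as in the Chu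
    construction, by two ideals, a refuting one and an affirming one, which
    duality exchanges and whose members are orthogonal: the par of a refuting and
    an affirming one is normally provable.  Every rule of full MAV shrinks the
    refuting ideal and enlarges the affirming one when read from premise to
    conclusion; the co-rules are sound because duality is an exchange.  Since [P]
    lies in its own refuting ideal and the refuting ideal of [One] consists of the
    normally provable structures, a proof of [P] makes [P] normally provable. *)

Set Implicit Arguments.

Local Open Scope mav_scope.

Local Notation "P ⟶ Q" := (normal_derives P Q) (at level 70, no associativity).

(** * Normal derivability as a preorder *)

Fixpoint context_comp (A : Type) (C D : context A) : context A :=
  match C with
  | Hole => D
  | CSeqL C Q => CSeqL (context_comp C D) Q
  | CSeqR P C => CSeqR P (context_comp C D)
  | CTensorL C Q => CTensorL (context_comp C D) Q
  | CTensorR P C => CTensorR P (context_comp C D)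
  | CParL C Q => CParL (context_comp C D) Q
  | CParR P C => CParR P (context_comp C D)
  | CWithL C Q => CWithL (context_comp C D) Q
  | CWithR P C => CWithR P (context_comp C D)
  | CPlusL C Q => CPlusL (context_comp C D) Q
  | CPlusR P C => CPlusR P (context_comp C D)
  end.

Lemma fill_context_comp (A : Type) (C D : context A) (P : structure A) :
  fill (context_comp C D) P = fill C (fill D P).
Proof. induction C; cbn; congruence. Qed.

Lemma fill_equiv (A : Type) (C : context A) (P Q : structure A) :
  P ≡ Q -> fill C P ≡ fill C Q.
Proof.
  intros e; induction C; cbn;
    auto using equiv_refl, equiv_Seq, equiv_Tensor, equiv_Par, equiv_With, equiv_Plus.
Qed.

Lemma derives_fill (A : Type) (rule : relation (structure A)) (C : context A)
    (P Q : structure A) :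
  derives rule P Q -> derives rule (fill C P) (fill C Q).
Proof.
  intros d; induction d as [P Q [e | (D & P0 & Q0 & eP & r & eQ)] | P | P Q R _ d1 _ d2].
  - apply rt_step; left; now apply fill_equiv.
  - apply rt_step; right; exists (context_comp C D), P0, Q0.
    rewrite !fill_context_comp; auto using fill_equiv.
  - apply rt_refl.
  - eapply rt_trans; eassumption.
Qed.

#[local] Instance equiv_Equivalence (A : Type) : Equivalence (@equiv A).
Proof. split; red; eauto using equiv. Qed.

#[local] Instance normal_derives_PreOrder (A : Type) : PreOrder (@normal_derives A).
Proof. split; [intros P; apply rt_refl | intros P Q R; apply rt_trans]. Qed.

#[local] Instance equiv_normal_derives (A : Type) :
  subrelation (@equiv A) (@normal_derives A).
Proof. intros P Q e; apply rt_step; now left. Qed.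

Lemma normal_rule_derives (A : Type) (P Q : structure A) : normal_rule P Q -> P ⟶ Q.
Proof.
  intros r; apply rt_step; right; exists Hole, P, Q; cbn; repeat split; auto using equiv_refl.
Qed.

#[local] Instance Par_equiv (A : Type) : Proper (@equiv A ==> @equiv A ==> @equiv A) (@Par A).
Proof. repeat intro; now apply equiv_Par. Qed.

#[local] Instance Seq_derives (A : Type) :
  Proper (@normal_derives A ==> @normal_derives A ==> @normal_derives A) (@Seq A).
Proof.
  intros P P' d Q Q' e; transitivity (P' ;; Q).
  - exact (derives_fill (CSeqL Hole Q) d).
  - exact (derives_fill (CSeqR P' Hole) e).
Qed.

#[local] Instance Tensor_derives (A : Type) :
  Proper (@normal_derives A ==> @normal_derives A ==> @normal_derives A) (@Tensor A).
Proof.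
  intros P P' d Q Q' e; transitivity (P' ⊗ Q).
  - exact (derives_fill (CTensorL Hole Q) d).
  - exact (derives_fill (CTensorR P' Hole) e).
Qed.

#[local] Instance Par_derives (A : Type) :
  Proper (@normal_derives A ==> @normal_derives A ==> @normal_derives A) (@Par A).
Proof.
  intros P P' d Q Q' e; transitivity (P' ⅋ Q).
  - exact (derives_fill (CParL Hole Q) d).
  - exact (derives_fill (CParR P' Hole) e).
Qed.

#[local] Instance With_derives (A : Type) :
  Proper (@normal_derives A ==> @normal_derives A ==> @normal_derives A) (@With A).
Proof.
  intros P P' d Q Q' e; transitivity (P' && Q).
  - exact (derives_fill (CWithL Hole Q) d).
  - exact (derives_fill (CWithR P' Hole) e).
Qed.

Lemma Par_rotate (A : Type) (P Q R : structure A) : (P ⅋ Q) ⅋ R ≡ (P ⅋ R) ⅋ Q.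
Proof. now rewrite !Par_assoc, (Par_comm Q R). Qed.

(** * Ideals *)

Record ideal (A : Type) : Type := Ideal {
  mem :> structure A -> Prop;
  mem_down : forall P Q, P ⟶ Q -> mem Q -> mem P;
  mem_With : forall P Q, mem P -> mem Q -> mem (P && Q) }.

#[local] Instance mem_equiv (A : Type) (I : ideal A) : Proper (@equiv A ==> iff) (mem I).
Proof.
  intros P Q e; split; apply mem_down; apply equiv_normal_derives; [symmetry |]; exact e.
Qed.

Definition incl (A : Type) (I J : ideal A) : Prop := forall P, I P -> J P.

#[local] Instance incl_PreOrder (A : Type) : PreOrder (@incl A).
Proof. split; unfold incl; red; auto. Qed.

(** Closure under [&&] is Tidy. This ideal is the unit of both products and the target of every
    orthogonality relation. *)
Definition provable (A : Type) : ideal A.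
Proof.
  refine (@Ideal A (fun P => P ⟶ One) _ _).
  - intros P Q d e; now transitivity Q.
  - intros P Q d e; rewrite d, e; apply normal_rule_derives, N_Tidy.
Defined.

Inductive closure (A : Type) (S : structure A -> Prop) : structure A -> Prop :=
| closure_gen P : S P -> closure S P
| closure_down P Q : P ⟶ Q -> closure S Q -> closure S P
| closure_With P Q : closure S P -> closure S Q -> closure S (P && Q).

Definition span (A : Type) (S : structure A -> Prop) : ideal A :=
  Ideal (closure S) (@closure_down A S) (@closure_With A S).

Lemma span_incl (A : Type) (S : structure A -> Prop) (I : ideal A) :
  (forall P, S P -> I P) -> incl (span S) I.
Proof. intros h P; induction 1; eauto using mem_down, mem_With. Qed.

Definition join (A : Type) (I J : ideal A) : ideal A := span (fun P => I P \/ J P).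

Definition par_ideal (A : Type) (I J : ideal A) : ideal A :=
  span (fun R => exists P Q, I P /\ J Q /\ R = P ⅋ Q).

Definition meet (A : Type) (I J : ideal A) : ideal A.
Proof.
  refine (@Ideal A (fun P => I P /\ J P) _ _).
  - intros P Q d [i j]; split; now apply mem_down with Q.
  - intros P Q [i j] [i' j']; split; now apply mem_With.
Defined.

(** External gives closure under [&&] for an arbitrary set [S]. With the singleton [eq R] for [S],
    the structures whose par with [R] lies in [J] form an ideal, so a claim about them need only be
    checked on generators. *)
Definition residual (A : Type) (S : structure A -> Prop) (J : ideal A) : ideal A.
Proof.
  refine (@Ideal A (fun P => forall Q, S Q -> J (P ⅋ Q)) _ _).
  - intros P Q d h R s; apply mem_down with (Q ⅋ R); [now rewrite d | auto].
  - intros P Q h k R s; apply mem_down with ((P ⅋ R) && (Q ⅋ R)); auto using mem_With.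
    apply normal_rule_derives, N_External.
Defined.

(** No [span] is taken: Medial merges two generators under [&&] into one, so every member keeps an
    explicit decomposition below some [P ;; Q]. *)
Definition seq_ideal (A : Type) (I J : ideal A) : ideal A.
Proof.
  refine (@Ideal A (fun R => exists P Q, I P /\ J Q /\ R ⟶ P ;; Q) _ _).
  - intros R R' d (P & Q & i & j & e); exists P, Q; repeat split; auto; now transitivity R'.
  - intros R R' (P & Q & i & j & e) (P' & Q' & i' & j' & e').
    exists (P && P'), (Q && Q'); repeat split; auto using mem_With.
    rewrite e, e'; apply normal_rule_derives, N_Medial.
Defined.

(* The component of a Chu tensor that is not [par_ideal], with [(I, I')] and
   [(J, J')] the two factors. *)
Definition cross (A : Type) (I I' J J' : ideal A) : ideal A :=
  meet (residual I J') (residual J I').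

(** * Introduction, elimination and monotonicity for the operations on ideals *)

Lemma par_ideal_gen (A : Type) (I J : ideal A) (P Q : structure A) :
  I P -> J Q -> par_ideal I J (P ⅋ Q).
Proof. intros i j; apply closure_gen; eauto. Qed.

Lemma par_ideal_incl (A : Type) (I J L : ideal A) :
  (forall P Q, I P -> J Q -> L (P ⅋ Q)) -> incl (par_ideal I J) L.
Proof. intros h; apply span_incl; intros R (P & Q & i & j & ->); auto. Qed.

(* Residuation lets one eliminate a product that occurs inside a par. *)
Lemma par_ideal_elim (A : Type) (I J L : ideal A) (R : structure A) :
  (forall P Q, I P -> J Q -> L (R ⅋ (P ⅋ Q))) ->
  forall S, par_ideal I J S -> L (R ⅋ S).
Proof.
  intros h S s; rewrite Par_comm.
  apply (@par_ideal_incl A I J (residual (eq R) L)); auto.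
  intros P Q i j R' <-; rewrite Par_comm; auto.
Qed.

Lemma join_l (A : Type) (I J : ideal A) (P : structure A) : I P -> join I J P.
Proof. intros i; apply closure_gen; auto. Qed.

Lemma join_r (A : Type) (I J : ideal A) (P : structure A) : J P -> join I J P.
Proof. intros j; apply closure_gen; auto. Qed.

Lemma join_incl (A : Type) (I J L : ideal A) : incl I L -> incl J L -> incl (join I J) L.
Proof. intros h k; apply span_incl; intros P [i | j]; auto. Qed.

Lemma join_elim (A : Type) (I J L : ideal A) (R : structure A) :
  (forall P, I P -> L (P ⅋ R)) -> (forall P, J P -> L (P ⅋ R)) ->
  forall P, join I J P -> L (P ⅋ R).
Proof.
  intros h k P p; apply (@join_incl A I J (residual (eq R) L)); trivial;
    intros Q q S <-; auto.
Qed.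

Lemma seq_ideal_gen (A : Type) (I J : ideal A) (P Q : structure A) :
  I P -> J Q -> seq_ideal I J (P ;; Q).
Proof. intros i j; exists P, Q; repeat split; auto; reflexivity. Qed.

Lemma seq_ideal_incl (A : Type) (I J L : ideal A) :
  (forall P Q, I P -> J Q -> L (P ;; Q)) -> incl (seq_ideal I J) L.
Proof. intros h R (P & Q & i & j & d); apply mem_down with (P ;; Q); auto. Qed.

#[local] Instance join_mono (A : Type) : Proper (@incl A ==> @incl A ==> @incl A) (@join A).
Proof. intros I I' h J J' k; apply join_incl; intros P i; [apply join_l | apply join_r]; auto. Qed.

#[local] Instance meet_mono (A : Type) : Proper (@incl A ==> @incl A ==> @incl A) (@meet A).
Proof. intros I I' h J J' k P [i j]; split; auto. Qed.

#[local] Instance par_ideal_mono (A : Type) :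
  Proper (@incl A ==> @incl A ==> @incl A) (@par_ideal A).
Proof. intros I I' h J J' k; apply par_ideal_incl; auto using par_ideal_gen. Qed.

#[local] Instance seq_ideal_mono (A : Type) :
  Proper (@incl A ==> @incl A ==> @incl A) (@seq_ideal A).
Proof. intros I I' h J J' k; apply seq_ideal_incl; auto using seq_ideal_gen. Qed.

Lemma cross_mono (A : Type) (I I' J J' L L' M M' : ideal A) :
  incl L I -> incl I' L' -> incl M J -> incl J' M' -> incl (cross I I' J J') (cross L L' M M').
Proof. intros h h' k k' P [p q]; split; intros Q i; [apply k', p | apply h', q]; auto. Qed.

(** * Algebra of [par_ideal] and [cross] *)

Lemma par_ideal_comm (A : Type) (I J : ideal A) : incl (par_ideal I J) (par_ideal J I).
Proof. apply par_ideal_incl; intros P Q i j; rewrite Par_comm; now apply par_ideal_gen. Qed.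

Lemma par_ideal_assoc (A : Type) (I J L : ideal A) :
  incl (par_ideal (par_ideal I J) L) (par_ideal I (par_ideal J L)).
Proof.
  apply par_ideal_incl; intros P R p r; rewrite Par_comm.
  apply par_ideal_elim with (2 := p); intros P1 P2 i j.
  rewrite Par_comm, Par_assoc; auto using par_ideal_gen.
Qed.

(** A member of [cross] acts by par as a pair of maps between ideals; the maps on the right arise
    from those on the left by currying and uncurrying. *)
Lemma cross_assoc (A : Type) (I I' J J' L L' : ideal A) :
  incl (cross (par_ideal I J) (cross I I' J J') L L')
       (cross I I' (par_ideal J L) (cross J J' L L')).
Proof.
  intros P [h k]; split.
  - intros Q i; split; intros R j.
    + rewrite Par_assoc; apply h; now apply par_ideal_gen.
    + rewrite Par_rotate; now apply k.
  - intros Q q; apply par_ideal_elim with (2 := q); intros R S j l.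
    rewrite (Par_comm R S), <- Par_assoc; now apply k.
Qed.

(** Switch moves [R] next to the factor it is orthogonal to, that pair collapses to [One], and the
    other factor remains. *)
Lemma cross_Tensor (A : Type) (I I' J J' : ideal A) (P Q : structure A) :
  (forall R, I R -> P ⅋ R ⟶ One) -> (forall R, J R -> Q ⅋ R ⟶ One) -> I' P -> J' Q ->
  cross I I' J J' (P ⊗ Q).
Proof.
  intros h k i j; split; intros R r.
  - apply mem_down with Q; trivial.
    rewrite (Tensor_comm P Q), (normal_rule_derives (N_Switch Q P R)), (h R r), Tensor_One.
    reflexivity.
  - apply mem_down with P; trivial.
    rewrite (normal_rule_derives (N_Switch P Q R)), (k R r), Tensor_One.
    reflexivity.
Qed.

(** * Interpretation *)

(* [sem true P] is the affirming ideal of [P] and [sem false P] the refuting one. *)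
Fixpoint sem (A : Type) (s : bool) (P : structure A) : ideal A :=
  match P with
  | Atom a =>
      let I := residual (eq (Atom a)) (provable A) in
      if s then I else residual I (provable A)
  | CoAtom a =>
      let I := residual (eq (Atom a)) (provable A) in
      if s then residual I (provable A) else I
  | One => provable A
  | P ;; Q => seq_ideal (sem s P) (sem s Q)
  | P ⊗ Q =>
      if s then par_ideal (sem true P) (sem true Q)
      else cross (sem true P) (sem false P) (sem true Q) (sem false Q)
  | P ⅋ Q =>
      if s then cross (sem false P) (sem true P) (sem false Q) (sem true Q)
      else par_ideal (sem false P) (sem false Q)
  | P && Q => if s then meet (sem s P) (sem s Q) else join (sem s P) (sem s Q)
  | P ⊕ Q => if s then join (sem s P) (sem s Q) else meet (sem s P) (sem s Q)
  end.

(** A Leibniz equality rather than mutual inclusion: dual connectives are interpreted by the same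
    operations on exchanged ideals. *)
Lemma sem_dual (A : Type) (P : structure A) (s : bool) : sem s (dual P) = sem (negb s) P.
Proof.
  revert s; induction P; intros []; cbn; rewrite ?IHP1, ?IHP2; reflexivity.
Qed.

(** * Orthogonality and self-membership *)

Lemma par_cross_orthogonal (A : Type) (I I' J J' : ideal A) :
  (forall P Q, I' P -> I Q -> P ⅋ Q ⟶ One) ->
  forall P Q, cross I I' J J' P -> par_ideal I J Q -> P ⅋ Q ⟶ One.
Proof.
  intros h P Q [_ p] q; apply (@par_ideal_elim A I J (provable A) P) with (2 := q).
  intros R S i j; cbn.
  (* [P ⅋ S] lies in [I'] by [p], and [h] pairs it with [R]. *)
  rewrite (Par_comm R S), <- Par_assoc; auto.
Qed.

Lemma join_meet_orthogonal (A : Type) (I I' J J' : ideal A) :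
  (forall P Q, I P -> I' Q -> P ⅋ Q ⟶ One) -> (forall P Q, J P -> J' Q -> P ⅋ Q ⟶ One) ->
  forall P Q, join I J P -> meet I' J' Q -> P ⅋ Q ⟶ One.
Proof.
  intros h k P Q p [i j].
  apply (@join_elim A I J (provable A) Q) with (3 := p); cbn; auto.
Qed.

(** Atoms are orthogonal by the choice of residuals, [;;] by Sequence, tensor and par by applying a
    member of [cross] to a component, and the additives by reducing a join to its generators. *)
Lemma sem_orthogonal (A : Type) (P Q R : structure A) :
  sem false P Q -> sem true P R -> Q ⅋ R ⟶ One.
Proof.
  revert Q R; induction P as [a | a | | P1 IH1 P2 IH2 | P1 IH1 P2 IH2 | P1 IH1 P2 IH2
    | P1 IH1 P2 IH2 | P1 IH1 P2 IH2]; intros Q R.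
  - cbn; auto.
  - cbn; intros q r; rewrite Par_comm; auto.
  - cbn; intros q r; now rewrite q, r, Par_One.
  - intros (Q1 & Q2 & q1 & q2 & dQ) (R1 & R2 & r1 & r2 & dR).
    rewrite dQ, dR, (normal_rule_derives (N_Sequence Q1 Q2 R1 R2)).
    rewrite (IH1 Q1 R1), (IH2 Q2 R2), Seq_One_l; trivial; reflexivity.
  - apply par_cross_orthogonal; exact IH1.
  - intros q r; rewrite Par_comm; revert r q; apply par_cross_orthogonal.
    intros S T s t; rewrite Par_comm; auto.
  - apply join_meet_orthogonal; auto.
  - intros q r; rewrite Par_comm; revert r q; apply join_meet_orthogonal;
      intros S T s t; rewrite Par_comm; auto.
Qed.

(** The second half is the first for [dual P], in view of [sem_dual]. For tensor and par,
    orthogonality is what puts a tensor into [cross]. *)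
Lemma sem_self (A : Type) (P : structure A) : sem false P P /\ sem true P (dual P).
Proof.
  induction P as [a | a | | P1 [n1 t1] P2 [n2 t2] | P1 [n1 t1] P2 [n2 t2]
    | P1 [n1 t1] P2 [n2 t2] | P1 [n1 t1] P2 [n2 t2] | P1 [n1 t1] P2 [n2 t2]]; cbn -[cross].
  - split.
    (* The refuting ideal of [Atom a] is the biorthogonal of its singleton, hence contains it. *)
    + intros Q q; rewrite Par_comm; auto.
    + intros Q <-; apply normal_rule_derives, N_AtomInteract.
  - split.
    + intros Q <-; apply normal_rule_derives, N_AtomInteract.
    + intros Q q; rewrite Par_comm; auto.
  - split; reflexivity.
  - split; now apply seq_ideal_gen.
  - split; [apply cross_Tensor; trivial; intros R r; eapply sem_orthogonal; eassumption |].
    now apply par_ideal_gen.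
  - split; [now apply par_ideal_gen |].
    apply cross_Tensor; trivial; intros R r; rewrite Par_comm; eapply sem_orthogonal; eassumption.
  (* Both components lie in the join, and closure of ideals under [&&] combines them; the affirming
     half uses Left and Right. *)
  - split; [apply closure_With; apply closure_gen; auto |].
    split; [apply mem_down with (dual P1) | apply mem_down with (dual P2)]; trivial;
      apply normal_rule_derives; constructor.
  - split; [| apply closure_With; apply closure_gen; auto].
    split; [apply mem_down with P1 | apply mem_down with P2]; trivial;
      apply normal_rule_derives; constructor.
Qed.

(** * Soundness of full MAV *)

(** The two inclusions travel together because duality exchanges them and [cross] is contravariant
    in its first and third arguments. *)
Definition refines (A : Type) (P Q : structure A) : Prop :=
  incl (sem false P) (sem false Q) /\ incl (sem true Q) (sem true P).

#[local] Instance refines_PreOrder (A : Type) : PreOrder (@refines A).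
Proof.
  split.
  - intros P; split; reflexivity.
  - intros P Q R [h h'] [k k']; split; [now transitivity (sem false Q) |].
    now transitivity (sem true Q).
Qed.

Lemma refines_dual (A : Type) (P Q : structure A) : refines (dual Q) (dual P) -> refines P Q.
Proof. unfold refines; rewrite !sem_dual; cbn; tauto. Qed.

#[local] Instance refines_Seq (A : Type) :
  Proper (@refines A ==> @refines A ==> @refines A) (@Seq A).
Proof. intros P P' [] Q Q' []; split; now apply seq_ideal_mono. Qed.

#[local] Instance refines_Tensor (A : Type) :
  Proper (@refines A ==> @refines A ==> @refines A) (@Tensor A).
Proof. intros P P' [] Q Q' []; split; [now apply cross_mono | now apply par_ideal_mono]. Qed.

#[local] Instance refines_Par (A : Type) :
  Proper (@refines A ==> @refines A ==> @refines A) (@Par A).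
Proof. intros P P' [] Q Q' []; split; [now apply par_ideal_mono | now apply cross_mono]. Qed.

#[local] Instance refines_With (A : Type) :
  Proper (@refines A ==> @refines A ==> @refines A) (@With A).
Proof. intros P P' [] Q Q' []; split; [now apply join_mono | now apply meet_mono]. Qed.

#[local] Instance refines_Plus (A : Type) :
  Proper (@refines A ==> @refines A ==> @refines A) (@Plus A).
Proof. intros P P' [] Q Q' []; split; [now apply meet_mono | now apply join_mono]. Qed.

Lemma refines_fill (A : Type) (C : context A) (P Q : structure A) :
  refines P Q -> refines (fill C P) (fill C Q).
Proof.
  intros h; induction C as [| C IH R | R C IH | C IH R | R C IH | C IH R | R C IH
    | C IH R | R C IH | C IH R | R C IH]; cbn; trivial; now rewrite IH.
Qed.

(** * Invariance under [≡] *)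

Lemma refines_Par_comm (A : Type) (P Q : structure A) : refines (P ⅋ Q) (Q ⅋ P).
Proof. split; [apply par_ideal_comm | intros R []; split; assumption]. Qed.

Lemma refines_Par_assoc_r (A : Type) (P Q R : structure A) :
  refines (P ⅋ (Q ⅋ R)) ((P ⅋ Q) ⅋ R).
Proof.
  split; [| apply cross_assoc].
  (* [par_ideal_assoc] regroups the other way, so it is conjugated by commutativity. *)
  cbn; rewrite (@par_ideal_comm A (sem false P)), (@par_ideal_comm A (sem false Q)).
  rewrite par_ideal_assoc, par_ideal_comm.
  now rewrite (@par_ideal_comm A (sem false Q)).
Qed.

Lemma refines_Par_assoc_l (A : Type) (P Q R : structure A) :
  refines ((P ⅋ Q) ⅋ R) (P ⅋ (Q ⅋ R)).
Proof.
  rewrite (refines_Par_comm (P ⅋ Q) R), (refines_Par_comm P Q), refines_Par_assoc_r.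
  rewrite (refines_Par_comm (R ⅋ Q) P), (refines_Par_comm R Q); reflexivity.
Qed.

Lemma refines_Par_One_l (A : Type) (P : structure A) : refines (P ⅋ One) P.
Proof.
  split; cbn.
  - apply par_ideal_incl; intros Q R q r; cbn in r; apply mem_down with Q; trivial.
    now rewrite r, Par_One.
  - intros Q q; split; intros R r; cbn in *.
    (* Members of [sem false P] must be sent to provable structures, which is orthogonality. *)
    + rewrite Par_comm; now apply sem_orthogonal with P.
    + apply mem_down with Q; trivial; now rewrite r, Par_One.
Qed.

Lemma refines_Par_One_r (A : Type) (P : structure A) : refines P (P ⅋ One).
Proof.
  split; cbn.
  - intros Q q; rewrite <- (Par_One Q); apply par_ideal_gen; cbn; trivial; reflexivity.
  - intros Q [_ q]; rewrite <- (Par_One Q); apply q; cbn; reflexivity.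
Qed.

Lemma seq_ideal_assoc (A : Type) (I J L : ideal A) :
  incl (seq_ideal (seq_ideal I J) L) (seq_ideal I (seq_ideal J L)) /\
  incl (seq_ideal I (seq_ideal J L)) (seq_ideal (seq_ideal I J) L).
Proof.
  split; apply seq_ideal_incl.
  - intros P R (P1 & P2 & i & j & d) l; apply mem_down with ((P1 ;; P2) ;; R); [now rewrite d |].
    rewrite Seq_assoc; auto using seq_ideal_gen.
  - intros P R i (P1 & P2 & j & l & d); apply mem_down with (P ;; (P1 ;; P2)); [now rewrite d |].
    rewrite <- Seq_assoc; auto using seq_ideal_gen.
Qed.

Lemma seq_ideal_provable_l (A : Type) (I : ideal A) :
  incl (seq_ideal (provable A) I) I /\ incl I (seq_ideal (provable A) I).
Proof.
  split.
  - apply seq_ideal_incl; intros P Q p q; cbn in p; apply mem_down with Q; trivial.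
    now rewrite p, Seq_One_l.
  - intros P p; rewrite <- (Seq_One_l P); apply seq_ideal_gen; cbn; trivial; reflexivity.
Qed.

Lemma seq_ideal_provable_r (A : Type) (I : ideal A) :
  incl (seq_ideal I (provable A)) I /\ incl I (seq_ideal I (provable A)).
Proof.
  split.
  - apply seq_ideal_incl; intros P Q p q; cbn in q; apply mem_down with P; trivial.
    now rewrite q, Seq_One_r.
  - intros P p; rewrite <- (Seq_One_r P); apply seq_ideal_gen; cbn; trivial; reflexivity.
Qed.

Lemma refines_equiv (A : Type) (P Q : structure A) : P ≡ Q -> refines P Q /\ refines Q P.
Proof.
  intros e; induction e as [P | P Q _ IH | P Q R _ [] _ [] | P P' Q Q' _ [] _ [] |
    P P' Q Q' _ [] _ [] | P P' Q Q' _ [] _ [] | P P' Q Q' _ [] _ [] | P P' Q Q' _ [] _ [] |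
    P Q R | P | P | P Q R | P Q | P | P Q R | P Q | P].
  - split; reflexivity.
  - tauto.
  - split; now transitivity Q.
  - split; now apply refines_Seq.
  - split; now apply refines_Tensor.
  - split; now apply refines_Par.
  - split; now apply refines_With.
  - split; now apply refines_Plus.
  - split; split; apply seq_ideal_assoc.
  - split; split; apply seq_ideal_provable_l.
  - split; split; apply seq_ideal_provable_r.
  (* The tensor laws are the par laws read through duality, which reverses their direction. *)
  - split; apply refines_dual; [apply refines_Par_assoc_r | apply refines_Par_assoc_l].
  - split; apply refines_dual, refines_Par_comm.
  - split; apply refines_dual; [apply refines_Par_One_r | apply refines_Par_One_l].
  - split; [apply refines_Par_assoc_l | apply refines_Par_assoc_r].
  - split; apply refines_Par_comm.
  - split; [apply refines_Par_One_l | apply refines_Par_One_r].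
Qed.

(** * The inference rules of MAV *)

(** The refuting half is orthogonality. For the affirming half, a provable structure acts by par as
    the identity on both ideals of [P]. *)
Lemma refines_Interact (A : Type) (P : structure A) : refines (P ⅋ dual P) One.
Proof.
  split; cbn; rewrite !sem_dual; cbn.
  - apply par_ideal_incl; intros Q R; apply sem_orthogonal.
  - intros Q q; cbn in q.
    split; intros R r; apply mem_down with R; trivial; now rewrite q, Par_comm, Par_One.
Qed.

(** With members of [cross] read as maps, both inclusions amount to composing maps and regrouping
    pars. *)
Lemma refines_Switch (A : Type) (P Q R : structure A) :
  refines ((P ⊗ Q) ⅋ R) (P ⊗ (Q ⅋ R)).
Proof.
  split; cbn -[cross]; apply par_ideal_incl.
  - intros S T [h k] t; split; intros U u.
    + rewrite Par_rotate; apply par_ideal_gen; auto.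
    + rewrite Par_assoc, (Par_comm T U); apply k; now apply u.
  - intros S T s [h k]; split; intros U u.
    + rewrite Par_rotate, Par_comm, (Par_comm S U); apply h; now apply u.
    + rewrite Par_assoc; apply par_ideal_gen; auto.
Qed.

Lemma refines_Tidy (A : Type) : refines (@One A && One) One.
Proof. split; [now apply join_incl | intros P p; split; exact p]. Qed.

(** Interchange of [;;] with residuals, obtained from Sequence; it serves both components of [cross]
    in the affirming half of that rule. *)
Lemma seq_ideal_residual (A : Type) (I I' J J' : ideal A) :
  incl (seq_ideal (residual I I') (residual J J'))
       (residual (seq_ideal I J) (seq_ideal I' J')).
Proof.
  intros R (P & Q & p & q & d) R' (P' & Q' & i & j & d').
  apply mem_down with ((P ⅋ P') ;; (Q ⅋ Q')); auto using seq_ideal_gen.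
  rewrite d, d'; apply normal_rule_derives, N_Sequence.
Qed.

Lemma refines_Sequence (A : Type) (P Q R S : structure A) :
  refines ((P ;; Q) ⅋ (R ;; S)) ((P ⅋ R) ;; (Q ⅋ S)).
Proof.
  split; cbn -[cross].
  - apply par_ideal_incl; intros T U (T1 & T2 & t1 & t2 & dT) (U1 & U2 & u1 & u2 & dU).
    apply mem_down with ((T1 ⅋ U1) ;; (T2 ⅋ U2)); auto using seq_ideal_gen, par_ideal_gen.
    rewrite dT, dU; apply normal_rule_derives, N_Sequence.
  - intros T t; split; apply seq_ideal_residual; revert T t; apply seq_ideal_mono;
      intros T []; assumption.
Qed.

Lemma refines_Left (A : Type) (P Q : structure A) : refines (P ⊕ Q) P.
Proof. split; [intros R []; assumption | intros R; apply join_l]. Qed.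

Lemma refines_Right (A : Type) (P Q : structure A) : refines (P ⊕ Q) Q.
Proof. split; [intros R []; assumption | intros R; apply join_r]. Qed.

Lemma refines_External (A : Type) (P Q R : structure A) :
  refines ((P && Q) ⅋ R) ((P ⅋ R) && (Q ⅋ R)).
Proof.
  split; cbn -[cross].
  - apply par_ideal_incl; intros S T s t.
    apply join_elim with (3 := s); intros U u; [apply join_l | apply join_r];
      now apply par_ideal_gen.
  - intros S [[h k] [h' k']]; split; intros T t.
    + rewrite Par_comm; apply join_elim with (3 := t); intros U u; rewrite Par_comm; auto.
    + split; auto.
Qed.

Lemma refines_Medial (A : Type) (P Q R S : structure A) :
  refines ((P ;; Q) && (R ;; S)) ((P && R) ;; (Q && S)).
Proof.
  split; cbn.
  - apply join_incl; apply seq_ideal_mono; intros T t; auto using join_l, join_r.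
  - intros T t; split; revert T t; apply seq_ideal_mono; intros T []; assumption.
Qed.

Lemma refines_mav_rule (A : Type) (P Q : structure A) : mav_rule P Q -> refines P Q.
Proof.
  intros []; auto using refines_Interact, refines_Switch, refines_Tidy, refines_Sequence,
    refines_Left, refines_Right, refines_External, refines_Medial;
    (* Only the co-rules remain. Dualizing and swapping the two sides of each gives an ordinary
       rule; CoInteract at [P] becomes Interact at [dual P]. *)
    apply refines_dual; cbn;
    auto using refines_Interact, refines_Tidy, refines_Sequence,
      refines_Left, refines_Right, refines_External, refines_Medial.
Qed.

Lemma refines_mav_derives (A : Type) (P Q : structure A) : mav_derives P Q -> refines P Q.
Proof.
  intros d; induction d as [P Q [e | (C & P0 & Q0 & eP & r & eQ)] | P | P Q R _ h _ k].
  - now apply refines_equiv.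
  - apply refines_equiv in eP, eQ; apply refines_mav_rule in r.
    transitivity (fill C P0); [apply eP |].
    transitivity (fill C Q0); [now apply refines_fill | apply eQ].
  - reflexivity.
  - now transitivity Q.
Qed.

Theorem theorem4p2 (A : Type) (P : structure A) :
  mav_derives P One -> normal_derives P One.
Proof.
  intros d; apply (refines_mav_derives d), sem_self.
Qed.
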